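(* Let $T\ge1$, $n\ge2$, $\mu\in\mathbb{R}$, $\sigma>0$, $z^*\in\mathbb{R}$, $\tau\in\{1,\dots,T\}$. Under $\mathbf{H_0}$ the real numbers $X_{t,k}$ ($t\le T$, $k\le n$) are i.i.d. $\mathcal{N}(\mu,\sigma^2)$; under $\mathbf{H_1^\tau}$ they are generated the same way and then $X_{\tau,J}$ is replaced by $z^*$, with $J$ uniform on $\{1,\dots,n\}$ independent of the data. Let $\bar X_\tau=\frac1n\sum_{k=1}^nX_{\tau,k}$ and \[ \log\mathrm{LR}_\tau=-\frac12\log\Big(\frac{n-1}{n}\Big)-\frac{n}{2(n-1)\sigma^2}(\bar X_\tau-\mu)^2+\frac{(z^*-\mu)n}{(n-1)\sigma^2}(\bar X_\tau-\mu)-\frac{(z^*-\mu)^2}{2(n-1)\sigma^2}. \] For $\gamma\in\mathbb{R}$ let $\beta(\gamma)=\mathbb{P}_{\mathbf{H_1^\tau}}(\log\mathrm{LR}_\tau<\gamma)$. Define $\gamma_{\max}=\frac12\big[\frac{(z^*-\mu)^2}{\sigma^2}-\log\big(\frac{n-1}{n}\big)\big]$, $m^*=\frac{(z^*-\mu)^2}{\sigma^2}$, $a=\sqrt{m^*n}$ and $b(\gamma)=\sqrt{(n-1)\big(m^*-\log(1-\frac1n)-2\gamma\big)}$. Then for every $\gamma\le\gamma_{\max}$, \[ \beta(\gamma)=\Phi\Big(a\sqrt{\tfrac{n-1}{n}}-b(\gamma)\sqrt{\tfrac{n}{n-1}}\Big)+\Phi\Big(-a\sqrt{\tfrac{n-1}{n}}-b(\gamma)\sqrt{\tfrac{n}{n-1}}\Big),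 \] where $\Phi$ is the standard normal cumulative distribution function.
   Context: $\beta(\gamma)$ is the Type II error of the test that declares ''target present'' when $\log\mathrm{LR}_\tau\ge\gamma$. *)

(* Defs.v *)
From HB Require Import structures.
From mathcomp Require Import all_boot all_order all_algebra.
From mathcomp Require Import all_classical all_reals all_analysis.
Set Implicit Arguments. Unset Strict Implicit. Unset Printing Implicit Defensive.
Import Order.TTheory GRing.Theory Num.Theory.
Local Open Scope classical_set_scope.
Local Open Scope ring_scope.

Section defs.
Context {R : realType}.

Definition Phi (x : R) : R := fine (normal_prob 0 1 `]-oo, x]).

Definition rowmean (n : nat) (x : 'I_n -> R) : R :=
  (n%:R)^-1 * \sum_(k < n) x k.

Definition logLR (n : nat) (mu sigma zs xbar : R) : R :=
  - (1/2) * ln ((n%:R - 1) / n%:R)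
  - n%:R / (2 * (n%:R - 1) * sigma ^+ 2) * (xbar - mu) ^+ 2
  + (zs - mu) * n%:R / ((n%:R - 1) * sigma ^+ 2) * (xbar - mu)
  - (zs - mu) ^+ 2 / (2 * (n%:R - 1) * sigma ^+ 2).

Definition gamma_max (n : nat) (mu sigma zs : R) : R :=
  (1/2) * ((zs - mu) ^+ 2 / sigma ^+ 2 - ln ((n%:R - 1) / n%:R)).

Definition mstar (mu sigma zs : R) : R := (zs - mu) ^+ 2 / sigma ^+ 2.

Definition acoef (n : nat) (mu sigma zs : R) : R :=
  Num.sqrt (mstar mu sigma zs * n%:R).

Definition bcoef (n : nat) (mu sigma zs gamma : R) : R :=
  Num.sqrt ((n%:R - 1) * (mstar mu sigma zs - ln (1 - (n%:R)^-1) - 2 * gamma)).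

End defs.

Section model.
Context {R : realType} {d : measure_display} {Omega : measurableType d}.
Variable P : probability Omega R.

(** Hypothesis H_0 together with the auxiliary index J:
    the X t k (t < T, k < n) are i.i.d. N(mu, sigma^2), J is uniform on
    'I_n, and J is independent of the data.  Since there are finitely many
    variables, mutual independence is stated as the product rule for all
    rectangles (taking full sets gives all sub-families). *)
Definition H0_with_index (T n : nat) (X : 'I_T -> 'I_n -> Omega -> R)
    (J : Omega -> 'I_n) (mu sigma : R) : Prop :=
  [/\ (forall t k, measurable_fun setT (X t k)),
      (forall j : 'I_n, measurable (J @^-1` [set j])),
      (forall j : 'I_n, P (J @^-1` [set j]) = ((n%:R)^-1)%:E),
      (forall t k (B : set R), measurable B ->
          P (X t k @^-1` B) = normal_prob mu sigma B) &
      (forall (A : set 'I_n) (B : 'I_T -> 'I_n -> set R),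
          (forall t k, measurable (B t k)) ->
          P ([set w | A (J w)] `&` [set w | forall t k, B t k (X t k w)]) =
          (P [set w | A (J w)] *
             \prod_(t < T) \prod_(k < n) P (X t k @^-1` B t k))%E)].

Definition H1_data (T n : nat) (X : 'I_T -> 'I_n -> Omega -> R)
    (J : Omega -> 'I_n) (tau : 'I_T) (zs : R) (t : 'I_T) (k : 'I_n)
    (w : Omega) : R :=
  if (t == tau) && (k == J w) then zs else X t k w.

Definition beta (T n : nat) (X : 'I_T -> 'I_n -> Omega -> R)
    (J : Omega -> 'I_n) (tau : 'I_T) (mu sigma zs gamma : R) : \bar R :=
  P [set w | logLR n mu sigma zs
               (rowmean (fun k => H1_data X J tau zs tau k w)) < gamma].

End model.

(* Main.v *)
Require Import Defs.
From mathcomp Require Import all_boot all_order all_algebra.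
From mathcomp Require Import all_classical all_reals all_analysis.
From mathcomp Require Import measurable_realfun ring lra.
Set Implicit Arguments.
Unset Strict Implicit.
Unset Printing Implicit Defensive.
Import Order.TTheory GRing.Theory Num.Theory.
Local Open Scope classical_set_scope.
Local Open Scope ring_scope.

(** Completing the square, [logLR] equals [gamma_max] minus a positive multiple
    of [(xbar - zs)^2], so the test misses the target exactly when the sample
    mean is far from [zs].  Given [J = j], the row sum is [zs] plus the sum of
    the [n - 1] remaining observations, which is normal with mean [(n - 1) mu]
    and variance [(n - 1) sigma^2]: for two independent normal variables the
    convolution of the densities is computed by completing the square, and
    induction on the number of summands gives the general case.  This law does
    not depend on [j], so averaging over [J] changes nothing.  After
    standardisation the miss event is [b < |z - c|] for a standard normal [z],
    with [c = (zs - mu) sqrt (n - 1) / sigma], [a sqrt ((n - 1) / n) = |c|] and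
    [b = b(gamma) sqrt (n / (n - 1))]; its two tails give the two terms. *)

Section lebesgue_affine.
Context {R : realType}.
Local Notation leb := (@lebesgue_measure R).
Implicit Types (a b : R) (A : set R) (f : R -> \bar R).
Local Open Scope ereal_scope.

Lemma measurable_affine a b :
  measurable_fun [set: measurableTypeR R]
    (fun x : measurableTypeR R => (a * x + b)%R : measurableTypeR R).
Proof. by apply: measurable_funD => //; exact: measurable_funM. Qed.

Let affine_image_measure a b : {measure set (measurableTypeR R) -> \bar R} :=
  mscale (NngNum (normr_ge0 a))
    (measure_function_pushforward__canonical__measure_function_Measure
      leb (measurable_affine a b)).

Lemma lebesgue_measure_affine a b A : (a != 0)%R -> measurable A ->
  leb A = `|a|%R%:E * leb ((fun x => a * x + b)%R @^-1` A).
Proof.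
move=> a0 mA.
rewrite (@lebesgue_measure_unique R (affine_image_measure a b))//.
move=> _ [[c d]] /= _ <-.
rewrite /affine_image_measure/= /mscale/= /pushforward/=.
have [a_gt0|a_lt0|a_eq0] := ltrgtP 0%R a; last by rewrite -a_eq0 eqxx in a0.
- have -> : (fun x => a * x + b)%R @^-1` `]c, d] =
      `]((c - b) / a)%R, ((d - b) / a)%R]%classic.
    apply/seteqP; split => x /=; rewrite !in_itv/=;
      by rewrite ltr_pdivrMr// ler_pdivlMr// ltrBlDr lerBrDr (mulrC x).
  rewrite !lebesgue_measure_itv/= !lte_fin ltr_pM2r ?invr_gt0// ltrD2r.
  case: ifP => _; last by rewrite mule0.
  by rewrite -EFinM gtr0_norm//; congr EFin; field.
- have -> : (fun x => a * x + b)%R @^-1` `]c, d] =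
      `[((d - b) / a)%R, ((c - b) / a)%R[%classic.
    apply/seteqP; split => x /=; rewrite !in_itv/=;
      by rewrite ltr_ndivlMr// ler_ndivrMr// ltrBlDr lerBrDr (mulrC x) andbC.
  rewrite !lebesgue_measure_itv/= !lte_fin ltr_nM2r ?invr_lt0// ltrD2r.
  case: ifP => _; last by rewrite mule0.
  by rewrite -EFinM ltr0_norm//; congr EFin; field.
Qed.

Lemma ge0_integral_affine a b A f : (a != 0)%R -> measurable A ->
  measurable_fun A f -> (forall x, A x -> 0 <= f x) ->
  \int[leb]_(x in A) f x =
  `|a|%R%:E * \int[leb]_(x in (fun x => a * x + b)%R @^-1` A) f (a * x + b)%R.
Proof.
move=> a0 mA mf f0.
rewrite (@eq_measure_integral _ _ _ _ (affine_image_measure a b)); last first.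
  by move=> B mB _; exact: lebesgue_measure_affine.
rewrite ge0_integral_mscale// ge0_integral_pushforward//.
- exact: measurable_affine.
- by move=> x; rewrite inE; exact: f0.
Qed.

End lebesgue_affine.

Section density.
Context {d : measure_display} {T : measurableType d} {R : realType}.
Variable nu : {sigma_finite_measure set T -> \bar R}.
Variables (Q : {finite_measure set T -> \bar R}) (f : T -> R).
Local Open Scope ereal_scope.

Definition is_density : Prop :=
  [/\ measurable_fun setT f, (forall x, (0 <= f x)%R) &
      forall A, measurable A -> Q A = \int[nu]_(x in A) (f x)%:E].

Hypothesis Qf : is_density.

Lemma density_dominates : Q `<< nu.
Proof.
have [mf _ QE] := Qf; apply/null_content_dominatesP => A mA nuA0.
rewrite QE// null_set_integral//; apply: measurable_funTS.
exact/measurable_EFinP.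
Qed.

Lemma ge0_integral_density (h : T -> \bar R) :
  measurable_fun setT h -> (forall x, 0 <= h x) ->
  \int[Q]_x h x = \int[nu]_x (h x * (f x)%:E).
Proof.
move=> mh h0; have [mf _ QE] := Qf; have dom := density_dominates.
have irn := Radon_Nikodym_SigmaFinite.f_integrable dom.
rewrite -(Radon_Nikodym_SigmaFinite.change_of_variables dom)//.
apply: ae_eq_integral => //.
- by apply: emeasurable_funM => //; exact: measurable_int irn.
- by apply: emeasurable_funM => //; exact/measurable_EFinP.
- apply: ae_eqe_mul2l; apply: integral_ae_eq => //.
    exact/measurable_EFinP.
  by move=> A _ mA; rewrite -QE// -Radon_Nikodym_SigmaFinite.f_integral.
Qed.

End density.

Section fubini_tonelli_in.
Context {d1 d2 : measure_display} {T1 : measurableType d1}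
  {T2 : measurableType d2} {R : realType}.
Variables (m1 : {sigma_finite_measure set T1 -> \bar R})
  (m2 : {sigma_finite_measure set T2 -> \bar R}).
Local Open Scope ereal_scope.

Lemma fubini_tonelli_in (f : T1 * T2 -> \bar R) (D : set T2) :
  measurable D -> measurable_fun setT f -> (forall p, 0 <= f p) ->
  \int[m1]_x \int[m2]_(y in D) f (x, y) = \int[m2]_(y in D) \int[m1]_x f (x, y).
Proof.
move=> mD mf f0; pose g p := f p * (\1_D p.2)%:E.
have mg : measurable_fun setT g.
  apply: emeasurable_funM => //; apply/measurable_EFinP.
  exact: (measurableT_comp (measurable_indic mD)).
have g0 p : 0 <= g p by rewrite mule_ge0// lee_fin.
under eq_integral => x _ do rewrite integral_mkcond epatch_indic.
rewrite (fubini_tonelli g mg g0) [RHS]integral_mkcond epatch_indic.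
apply: eq_integral => y _; rewrite /g/= ge0_integralZr//.
by apply: measurableT_comp => //; exact: measurable_pair2.
Qed.

End fubini_tonelli_in.

Section convolution.
Context {R : realType}.
Local Notation leb := (@lebesgue_measure R).
Local Open Scope ereal_scope.

Lemma measurable_add_preimage (C : set R) : measurable C ->
  measurable [set p : measurableTypeR R * measurableTypeR R | C (p.1 + p.2)%R].
Proof.
move=> mC.
have : measurable_fun setT
    (fun p : measurableTypeR R * measurableTypeR R => (p.1 + p.2)%R).
  exact: measurable_funD.
by move=> /(_ measurableT _ mC); rewrite setTI.
Qed.

Variables (Q1 Q2 : {finite_measure set (measurableTypeR R) -> \bar R}).
Variables (f1 f2 : R -> R).
Hypotheses (Qf1 : is_density leb Q1 f1) (Qf2 : is_density leb Q2 f2).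

Lemma density_shift (C : set R) (x : R) : measurable C ->
  Q2 [set y | C (x + y)%R] = \int[leb]_(z in C) (f2 (z - x))%:E.
Proof.
move=> mC; have [mf2 f20 Q2E] := Qf2.
have mxC : measurable [set y | C (x + y)%R].
  have := measurable_affine 1 x measurableT mC; rewrite setTI.
  by congr measurable; apply/seteqP; split => y /=; rewrite mul1r addrC.
rewrite Q2E// [LHS](ge0_integral_affine (- x) (oner_neq0 R))//; last 2 first.
- by apply: measurable_funTS; exact/measurable_EFinP.
- by move=> y _; rewrite lee_fin.
rewrite normr1 mul1e; under eq_integral do rewrite mul1r.
congr (integral _ _ _); apply/seteqP.
by split => z /=; rewrite mul1r subrKC.
Qed.

Lemma convolution_density (C : set R) : measurable C ->
  (Q1 \x Q2) [set p | C (p.1 + p.2)%R] =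
  \int[leb]_(z in C) \int[leb]_x (f1 x * f2 (z - x))%:E.
Proof.
move=> mC; have [mf1 f10 _] := Qf1; have [mf2 f20 _] := Qf2.
set D := [set p | _]; have mD : measurable D by exact: measurable_add_preimage.
have mf2B : measurable_fun setT
    (fun p : measurableTypeR R * measurableTypeR R => f2 (p.2 - p.1)).
  by apply: (measurableT_comp mf2); exact: measurable_funB.
rewrite -(@fubini_tonelli_in _ _ _ _ _ leb leb
  (fun p => (f1 p.1 * f2 (p.2 - p.1))%:E))//; last 2 first.
- apply/measurable_EFinP; apply: measurable_funM => //.
  exact: (measurableT_comp mf1).
- by move=> p; rewrite lee_fin mulr_ge0.
rewrite [LHS](ge0_integral_density Qf1)//; last exact: measurable_fun_xsection.
apply: eq_integral => x _ /=.
rewrite (_ : xsection D x = [set y | C (x + y)%R]); last first.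
  by apply/seteqP; split => y; rewrite /xsection/= inE.
rewrite density_shift// muleC -ge0_integralZl//.
- apply: measurable_funTS; apply/measurable_EFinP.
  by apply: (measurableT_comp mf2); exact: measurable_funB.
- by move=> z _; rewrite lee_fin.
- by rewrite lee_fin.
Qed.

End convolution.

Section normal_law.
Context {R : realType}.
Local Notation leb := (@lebesgue_measure R).
Implicit Types (m s a b : R) (A C : set R).

Lemma normal_prob_density m s :
  is_density leb (normal_prob m s) (normal_pdf m s).
Proof.
by split => //; [exact: measurable_normal_pdf|exact: normal_pdf_ge0].
Qed.

Lemma normal_peakE s : normal_peak s = (`|s| * Num.sqrt (pi *+ 2))^-1.
Proof. by rewrite /normal_peak -mulrnAr sqrtrM ?sqr_ge0// sqrtr_sqr. Qed.

Lemma normal_pdf_norm m s : normal_pdf m `|s| = normal_pdf m s.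
Proof.
have [->|s0] := eqVneq s 0; first by rewrite normr0.
rewrite !normal_pdfE ?normr_eq0//; apply/funext => x.
by rewrite /normal_peak /normal_fun real_normK ?num_real.
Qed.

Lemma normal_prob_norm m s A : normal_prob m `|s| A = normal_prob m s A.
Proof. by rewrite /normal_prob normal_pdf_norm. Qed.

Lemma normal_pdf_affine m s a b x : a != 0 -> s != 0 ->
  `|a| * normal_pdf (a * m + b) (a * s) (a * x + b) = normal_pdf m s x.
Proof.
move=> a0 s0; rewrite !normal_pdfE ?mulf_neq0//= mulrA; congr (_ * _).
  by rewrite !normal_peakE normrM -mulrA invfM mulVKf// normr_eq0.
rewrite /normal_fun; congr expR.
by field; rewrite a0 s0.
Qed.

Lemma normal_prob_affine m s a b A : a != 0 -> s != 0 -> measurable A ->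
  normal_prob (a * m + b) (a * s) A =
  normal_prob m s ((fun x => a * x + b) @^-1` A).
Proof.
move=> a0 s0 mA.
rewrite /normal_prob (ge0_integral_affine b a0)//; last 2 first.
- by apply/measurable_funTS/measurable_EFinP; exact: measurable_normal_pdf.
- by move=> x _; rewrite lee_fin normal_pdf_ge0.
have mpreA : measurable ((fun x : R => a * x + b) @^-1` A).
  by rewrite -[_ @^-1` _]setTI; exact: measurable_affine.
rewrite -ge0_integralZl//; last 2 first.
- apply: measurable_funTS; apply/measurable_EFinP.
  exact: (measurableT_comp (measurable_normal_pdf _ _) (measurable_affine a b)).
- by move=> x _; rewrite lee_fin normal_pdf_ge0.
by apply: eq_integral => x _; rewrite -EFinM normal_pdf_affine.
Qed.

Lemma normal_prob_opp m s A : s != 0 -> measurable A ->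
  normal_prob (- m) s A = normal_prob m s (-%R @^-1` A).
Proof.
move=> s0 mA; rewrite -[LHS]normal_prob_norm -normrN normal_prob_norm.
have N1_neq0 : -1 != 0 :> R by rewrite oppr_eq0 oner_neq0.
have := normal_prob_affine m 0 N1_neq0 s0 mA; rewrite !mulN1r addr0 => ->.
by congr (normal_prob m s _); apply/seteqP; split => x /=; rewrite mulN1r addr0.
Qed.

(* Completing the square in [x]. *)
Lemma normal_pdf_mul m1 s1 m2 s2 x z : s1 != 0 -> s2 != 0 ->
  let s := Num.sqrt (s1 ^+ 2 + s2 ^+ 2) in
  normal_pdf m1 s1 x * normal_pdf m2 s2 (z - x) =
  normal_pdf (m1 + m2) s z *
    normal_pdf ((m1 * s2 ^+ 2 + (z - m2) * s1 ^+ 2) / s ^+ 2) (s1 * s2 / s) x.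
Proof.
move=> s10 s20 s.
have sum_sqr_gt0 : 0 < s1 ^+ 2 + s2 ^+ 2 by rewrite addr_gt0// exprn_even_gt0.
have s0 : 0 < s by rewrite sqrtr_gt0.
have s_sqr : s ^+ 2 = s1 ^+ 2 + s2 ^+ 2 by rewrite sqr_sqrtr// ltW.
have cond_sd_neq0 : s1 * s2 / s != 0 by rewrite !mulf_neq0// invr_eq0 gt_eqF.
rewrite !normal_pdfE// ?gt_eqF//= mulrACA [in RHS]mulrACA; congr (_ * _).
  have sqrt2pi0 : Num.sqrt (pi *+ 2) != 0 :> R.
    by rewrite gt_eqF// sqrtr_gt0 pmulrn_lgt0// pi_gt0.
  rewrite !normal_peakE !normrM normfV (gtr0_norm s0).
  by field; rewrite sqrt2pi0 !normr_eq0 s10 s20 gt_eqF.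
rewrite /normal_fun -!expRD; congr expR.
rewrite !expr_div_n s_sqr.
by field; rewrite s10 s20 gt_eqF.
Qed.

Local Open Scope ereal_scope.

Lemma normal_prob_add m1 s1 m2 s2 C :
  (s1 != 0)%R -> (s2 != 0)%R -> measurable C ->
  (normal_prob m1 s1 \x normal_prob m2 s2) [set p | C (p.1 + p.2)%R] =
  normal_prob (m1 + m2)%R (Num.sqrt (s1 ^+ 2 + s2 ^+ 2)) C.
Proof.
move=> s10 s20 mC; rewrite [LHS](@convolution_density _ _ _
  (normal_pdf m1 s1) (normal_pdf m2 s2))//; try exact: normal_prob_density.
apply: eq_integral => z _.
under eq_integral do rewrite normal_pdf_mul// EFinM.
rewrite ge0_integralZl ?integral_normal_pdf ?mule1//.
- by apply/measurable_EFinP; exact: measurable_normal_pdf.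
- by move=> x _; rewrite lee_fin normal_pdf_ge0.
- by rewrite lee_fin normal_pdf_ge0.
Qed.

Lemma normal_prob_set1 m s (x : R) : normal_prob m s [set x] = 0.
Proof.
have /null_content_dominatesP := normal_prob_dominates m s; apply => //.
exact: lebesgue_measure_set1.
Qed.

End normal_law.

Section standard_normal_cdf.
Context {R : realType}.
Implicit Types x c b : R.
Local Open Scope ereal_scope.

Lemma normal_prob_lt x : normal_prob 0 1 `]-oo, x[ = (Phi x)%:E.
Proof.
rewrite /Phi fineK ?fin_num_measure// -(@setUitv1 _ _ -oo%O x true)//.
rewrite measureU//.
  by rewrite [X in _ + X]normal_prob_set1 adde0.
by apply/seteqP; split => y //= [+ yx]; rewrite yx in_itv/= ltxx.
Qed.

Lemma normal_prob_gt x : normal_prob 0 1 `]x, +oo[ = (Phi (- x))%:E.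
Proof.
rewrite -normal_prob_lt; transitivity (normal_prob (- 0) 1 `]x, +oo[%classic).
  by rewrite oppr0.
rewrite normal_prob_opp ?oner_neq0//; congr (normal_prob 0 1 _); apply/seteqP.
by split => y /=; rewrite !in_itv/= andbT ltrNr.
Qed.

Lemma normal_prob_tails c b : (0 <= b)%R ->
  normal_prob 0 1 [set z | (b < `|z - c|)%R] =
  (Phi (c - b) + Phi (- c - b))%:E.
Proof.
move=> b0.
rewrite (_ : [set z | _] = `]-oo, (c - b)%R[ `|` `](c + b)%R, +oo[); last first.
  apply/seteqP; split => z /=; rewrite !in_itv/= andbT ltr_normr.
    by case/orP => ?; [right|left]; lra.
  by case=> ?; apply/orP; [right|left]; lra.
rewrite measureU//; last first.
  apply/seteqP; split => z //=; rewrite !in_itv/= andbT => -[]; lra.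
by rewrite [X in X + _]normal_prob_lt [X in _ + X]normal_prob_gt opprD EFinD.
Qed.

End standard_normal_cdf.

Section independent_with_laws.
Context {d d' : measure_display} {Omega : measurableType d}
  {T : measurableType d'} {R : realType} {I : eqType}.
Local Open Scope ereal_scope.

(* For a probability [Q] this is mutual independence of the [Y i], [i \in r],
   with laws [nu i].  Allowing total mass [Q setT] turns conditioning on an
   event into restriction of [Q] to it, without normalising. *)
Definition independent_with_laws (Q : set Omega -> \bar R)
    (Y : I -> Omega -> T) (nu : I -> set T -> \bar R) (r : seq I) : Prop :=
  forall B : I -> set T, (forall i, measurable (B i)) ->
  Q [set w | forall i, i \in r -> B i (Y i w)] =
  Q setT * \prod_(i <- r) nu i (B i).

Variables (Q : {measure set Omega -> \bar R}) (Y : I -> Omega -> T).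
Variable nu : I -> set T -> \bar R.
Hypothesis nuT : forall i, nu i setT = 1.

Lemma independent_with_laws_cons (i : I) (r : seq I) (A : set T)
    (B : I -> set T) :
  i \notin r -> independent_with_laws Q Y nu (i :: r) ->
  measurable A -> (forall j, measurable (B j)) ->
  Q [set w | A (Y i w) /\ forall j, j \in r -> B j (Y j w)] =
  Q setT * (nu i A * \prod_(j <- r) nu j (B j)).
Proof.
move=> ir indep mA mB; pose AB j := if j == i then A else B j.
have ABr j : j \in r -> AB j = B j.
  by rewrite /AB; case: eqP => // ->; rewrite (negbTE ir).
have ABi : AB i = A by rewrite /AB eqxx.
have := indep AB; rewrite big_cons ABi.
rewrite (eq_big_seq (fun j => nu j (B j))) => [<-|j /ABr ->//]; last first.
  by move=> j; rewrite /AB; case: ifP.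
congr (Q _); apply/seteqP; split => w /=.
  move=> [Aw Bw] j; rewrite inE => /predU1P[->|jr]; first by rewrite ABi.
  by rewrite ABr//; exact: Bw.
move=> ABw; split; first by rewrite -ABi; apply: ABw; rewrite mem_head.
by move=> j jr; rewrite -ABr//; apply: ABw; rewrite inE jr orbT.
Qed.

Lemma independent_with_laws_head (i : I) (r : seq I) (A : set T) :
  i \notin r -> independent_with_laws Q Y nu (i :: r) -> measurable A ->
  Q (Y i @^-1` A) = Q setT * nu i A.
Proof.
move=> ir indep mA.
have := independent_with_laws_cons ir indep mA (fun=> measurableT).
rewrite big1 ?mule1 => [<-|//].
by congr (Q _); apply/seteqP; split => w //= [].
Qed.

Lemma independent_with_laws_behead (i : I) (r : seq I) (A : set T)
    (mYA : measurable (Y i @^-1` A)) :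
  i \notin r -> independent_with_laws Q Y nu (i :: r) -> measurable A ->
  independent_with_laws (mrestr Q mYA) Y nu r.
Proof.
move=> ir indep mA B mB; rewrite /mrestr setTI setIC.
rewrite (independent_with_laws_head ir indep mA) -muleA.
exact: independent_with_laws_cons.
Qed.

End independent_with_laws.

Section joint_law.
Context {d d1 d2 : measure_display} {Omega : measurableType d}
  {T1 : measurableType d1} {T2 : measurableType d2} {R : realType}.
Local Open Scope ereal_scope.

Lemma product_measure_preimage (Q : {measure set Omega -> \bar R})
    (nu1 : {sigma_finite_measure set T1 -> \bar R})
    (nu2 : {sigma_finite_measure set T2 -> \bar R})
    (Y1 : Omega -> T1) (Y2 : Omega -> T2) (D : set (T1 * T2)) :
  measurable_fun setT Y1 -> measurable_fun setT Y2 ->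
  (forall A B, measurable A -> measurable B ->
    Q (Y1 @^-1` A `&` Y2 @^-1` B) = nu1 A * nu2 B) ->
  measurable D -> Q [set w | D (Y1 w, Y2 w)] = (nu1 \x nu2) D.
Proof.
move=> mY1 mY2 QE mD; have mY := measurable_fun_pair mY1 mY2.
by rewrite (@product_measure_unique _ _ _ _ _ nu1 nu2
  (measure_function_pushforward__canonical__measure_function_Measure Q mY)).
Qed.

Lemma product_measure_mscalel (c : {nonneg R})
    (nu1 : {finite_measure set T1 -> \bar R})
    (nu2 : {sigma_finite_measure set T2 -> \bar R}) (D : set (T1 * T2)) :
  measurable D ->
  (mscale c nu1 \x nu2) D = c%:num%:E * (nu1 \x nu2) D.
Proof.
move=> mD; rewrite /product_measure1/= ge0_integral_mscale//.
exact: measurable_fun_xsection.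
Qed.

End joint_law.

Section sum_of_normals.
Context {d : measure_display} {Omega : measurableType d} {R : realType}.
Local Open Scope ereal_scope.

Lemma measure_add_normal (Q : {finite_measure set Omega -> \bar R})
    (Y1 Y2 : Omega -> R) (m1 s1 m2 s2 : R) (C : set R) :
  measurable_fun setT Y1 -> measurable_fun setT Y2 ->
  (s1 != 0)%R -> (s2 != 0)%R ->
  (forall A B, measurable A -> measurable B ->
    Q (Y1 @^-1` A `&` Y2 @^-1` B) =
    Q setT * (normal_prob m1 s1 A * normal_prob m2 s2 B)) ->
  measurable C ->
  Q [set w | C (Y1 w + Y2 w)%R] =
  Q setT * normal_prob (m1 + m2)%R (Num.sqrt (s1 ^+ 2 + s2 ^+ 2)) C.
Proof.
move=> mY1 mY2 s10 s20 QE mC.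
have [c QT] : exists c : {nonneg R}, Q setT = c%:num%:E.
  exists (NngNum (fine_ge0 (measure_ge0 Q setT))).
  by rewrite fineK// fin_num_measure.
have mD := measurable_add_preimage mC.
rewrite -normal_prob_add// QT -product_measure_mscalel//.
apply: (@product_measure_preimage _ _ _ _ (measurableTypeR R)
  (measurableTypeR R) _ Q _ _ Y1 Y2 _ mY1 mY2 _ mD) => A B mA mB.
by rewrite [LHS]QE// QT muleA.
Qed.

Lemma measure_sum_normal (I : eqType) (Q : {finite_measure set Omega -> \bar R})
    (Y : I -> Omega -> R) (m s : I -> R) (r : seq I) (C : set R) :
  (forall i, measurable_fun setT (Y i)) -> (forall i, s i != 0%R) ->
  uniq r -> r != [::] ->
  independent_with_laws Q Y (fun i => normal_prob (m i) (s i)) r ->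
  measurable C ->
  Q [set w | C (\sum_(i <- r) Y i w)%R] =
  Q setT * normal_prob (\sum_(i <- r) m i)%R
             (Num.sqrt (\sum_(i <- r) s i ^+ 2)) C.
Proof.
move=> mY s0; elim: r Q C => // i r IH Q C /= /andP[ir ur] _ indep mC.
have nuT j : normal_prob (m j) (s j) setT = 1 by exact: probability_setT.
rewrite !big_cons; under eq_set do rewrite big_cons.
have [->|r0] := eqVneq r [::].
  rewrite !big_nil !addr0 sqrtr_sqr normal_prob_norm.
  under eq_set do rewrite big_nil addr0.
  exact: (independent_with_laws_head nuT ir indep mC).
have sum_sqr_gt0 : (0 < \sum_(j <- r) s j ^+ 2)%R.
  case: r r0 {IH ir ur indep} => // j r _.
  rewrite big_cons ltr_pwDl ?exprn_even_gt0 ?s0//.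
  by apply: sumr_ge0 => k _; exact: sqr_ge0.
have sd_neq0 : (Num.sqrt (\sum_(j <- r) s j ^+ 2) != 0)%R.
  by rewrite gt_eqF// sqrtr_gt0.
rewrite -[in RHS](sqr_sqrtr (ltW sum_sqr_gt0)).
apply: measure_add_normal => // [|A B mA mB]; first exact: measurable_sum.
have mYA : measurable (Y i @^-1` A) by rewrite -[_ @^-1` _]setTI; exact: mY.
rewrite muleA -(independent_with_laws_head nuT ir indep mA) setIC.
have := IH (mrestr Q mYA) B ur r0; rewrite /= /mrestr setTI; apply => //.
exact: (independent_with_laws_behead nuT _ ir indep mA).
Qed.

End sum_of_normals.

Section total_probability.
Context {d : measure_display} {Omega : measurableType d} {R : realType}.
Local Open Scope ereal_scope.

Lemma measure_sum_fibers (I : finType) (Q : {measure set Omega -> \bar R})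
    (J : Omega -> I) (A : set Omega) :
  (forall i, measurable (A `&` J @^-1` [set i])) ->
  Q A = \sum_(i : I) Q (A `&` J @^-1` [set i]).
Proof.
move=> mAJ; rewrite fsbig_seq ?index_enum_uniq//.
rewrite -measure_fin_bigcup//; last exact: trivIset_preimage1_in.
congr (Q _); apply/seteqP; split => [w Aw|w [i _ []//]].
by exists (J w) => //=; exact: mem_index_enum.
Qed.

End total_probability.

Section log_likelihood_ratio.
Context {R : realType}.
Variables (n : nat) (mu sigma zs gamma : R).

Lemma measurable_logLR : measurable_fun setT (logLR n mu sigma zs).
Proof.
apply: measurable_funB => //; apply: measurable_funD.
  apply: measurable_funB => //; apply: measurable_funM => //.
  by apply: measurable_funX; exact: measurable_funB.
by apply: measurable_funM => //; exact: measurable_funB.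
Qed.

(* The values, for the sum of the [n - 1] observations of row [tau] that are
   not replaced by [zs], at which the test misses the target. *)
Definition missed_sums : set R :=
  [set y | logLR n mu sigma zs (n%:R^-1 * (zs + y)) < gamma].

Lemma measurable_missed_sums : measurable missed_sums.
Proof.
have mlogLR : measurable_fun setT
    (fun y : R => logLR n mu sigma zs (n%:R^-1 * (zs + y))).
  apply: (measurableT_comp measurable_logLR).
  by apply: measurable_funM => //; exact: measurable_funD.
have := mlogLR measurableT _ (measurable_itv `]-oo, gamma[).
by rewrite setTI set_itvE.
Qed.

Hypotheses (n_gt1 : (1 < n)%N) (sigma_neq0 : sigma != 0).

Let n_gt0 : 0 < n%:R :> R. Proof. by rewrite ltr0n ltnW. Qed.
Let n1_gt0 : 0 < n%:R - 1 :> R. Proof. by rewrite subr_gt0 ltr1n. Qed.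

Lemma logLR_square xbar :
  logLR n mu sigma zs xbar =
  gamma_max n mu sigma zs
  - n%:R / (2 * (n%:R - 1) * sigma ^+ 2) * (xbar - zs) ^+ 2.
Proof.
rewrite /logLR /gamma_max; set l := ln _.
by field; rewrite sigma_neq0 !gt_eqF.
Qed.

(* The target is declared present when the standardised sum of the unreplaced
   observations is within [hit_radius] of [hit_center]. *)
Definition hit_center : R := (zs - mu) / sigma * Num.sqrt (n%:R - 1).
Definition hit_radius : R :=
  bcoef n mu sigma zs gamma * Num.sqrt (n%:R / (n%:R - 1)).

Lemma hit_radius_ge0 : 0 <= hit_radius.
Proof. by rewrite mulr_ge0 ?sqrtr_ge0. Qed.

Lemma acoef_hit_center :
  acoef n mu sigma zs * Num.sqrt ((n%:R - 1) / n%:R) = `|hit_center|.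
Proof.
rewrite /acoef -sqrtrM; last first.
  by rewrite mulr_ge0 ?(ltW n_gt0)// divr_ge0 ?sqr_ge0.
rewrite -sqrtr_sqr; congr Num.sqrt.
rewrite /hit_center exprMn sqr_sqrtr ?ltW// /mstar.
by field; rewrite sigma_neq0 gt_eqF.
Qed.

Hypothesis gamma_le : gamma <= gamma_max n mu sigma zs.

Lemma hit_radius_sqr :
  hit_radius ^+ 2 = 2 * n%:R * (gamma_max n mu sigma zs - gamma).
Proof.
have lnE : 1 - n%:R^-1 = (n%:R - 1) / n%:R :> R by field; rewrite gt_eqF.
have bE : mstar mu sigma zs - ln (1 - n%:R^-1) - 2 * gamma =
    2 * (gamma_max n mu sigma zs - gamma).
  by rewrite lnE /mstar /gamma_max; lra.
rewrite /hit_radius /bcoef bE exprMn !sqr_sqrtr.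
- by field; rewrite gt_eqF.
- by rewrite divr_ge0// ltW.
- by rewrite mulr_ge0 ?(ltW n1_gt0)// mulr_ge0// subr_ge0.
Qed.

Lemma missed_sums_standardized :
  (fun z => sigma * Num.sqrt (n%:R - 1) * z + (n%:R - 1) * mu)
    @^-1` missed_sums =
  [set z | hit_radius < `|z - hit_center|].
Proof.
apply/funext => z; apply/propext; rewrite /missed_sums /= logLR_square.
set q := Num.sqrt (n%:R - 1).
have q_gt0 : 0 < q by rewrite sqrtr_gt0.
have q_sqr : q ^+ 2 = n%:R - 1 by rewrite sqr_sqrtr// ltW.
have -> : n%:R / (2 * (n%:R - 1) * sigma ^+ 2) *
    (n%:R^-1 * (zs + (sigma * q * z + (n%:R - 1) * mu)) - zs) ^+ 2 =
    (z - hit_center) ^+ 2 / (2 * n%:R).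
  have n_q : n%:R = q ^+ 2 + 1 by rewrite q_sqr subrK.
  rewrite /hit_center -/q -q_sqr n_q.
  by field; rewrite sigma_neq0 !gt_eqF// ?addr_gt0 ?exprn_gt0.
rewrite ltrBlDr -ltrBlDl ltr_pdivlMr ?mulr_gt0// mulrC -hit_radius_sqr.
rewrite -[X in _ < X](real_normK (num_real _)).
by rewrite ltr_sqr ?nnegrE ?hit_radius_ge0.
Qed.

Lemma normal_prob_missed_sums :
  normal_prob ((n%:R - 1) * mu) (sigma * Num.sqrt (n%:R - 1)) missed_sums =
  (Phi (`|hit_center| - hit_radius) + Phi (- `|hit_center| - hit_radius))%:E.
Proof.
have sd_neq0 : sigma * Num.sqrt (n%:R - 1) != 0.
  by rewrite mulf_neq0// gt_eqF// sqrtr_gt0.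
transitivity (normal_prob 0 1 [set z | hit_radius < `|z - hit_center|]).
  have := normal_prob_affine 0 ((n%:R - 1) * mu) sd_neq0 (oner_neq0 R)
    measurable_missed_sums.
  by rewrite mulr0 add0r mulr1 missed_sums_standardized.
rewrite normal_prob_tails ?hit_radius_ge0//; congr EFin.
by case: (ger0P hit_center) => _ //; rewrite opprK addrC.
Qed.

End log_likelihood_ratio.

Section type_II_error.
Context {R : realType} {d : measure_display} {Omega : measurableType d}.
Variables (P : probability Omega R) (T n : nat) (mu sigma : R).
Variables (X : 'I_T -> 'I_n -> Omega -> R) (J : Omega -> 'I_n).
Hypothesis H0 : H0_with_index P X J mu sigma.
Variable tau : 'I_T.
Local Open Scope ereal_scope.

Lemma rowmean_H1_data (zs : R) (w : Omega) :
  rowmean (fun k => H1_data X J tau zs tau k w) =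
  (n%:R^-1 * (zs + \sum_(k <- enum (predC1 (J w))) X tau k w))%R.
Proof.
rewrite /rowmean (bigD1 (J w))//= /H1_data !eqxx/=.
congr (_ * (_ + _))%R; rewrite big_enum/=.
by apply: eq_bigr => k /negbTE ->.
Qed.

Lemma unreplaced_row_independent (j : 'I_n)
    (mJj : measurable (J @^-1` [set j])) :
  independent_with_laws (mrestr P mJj) (X tau) (fun=> normal_prob mu sigma)
    (enum (predC1 j)).
Proof.
have [_ _ _ PX indep] := H0 => B mB; rewrite /mrestr setTI setIC.
pose box t k := if (t == tau) && (k != j) then B k else setT.
have mbox t k : measurable (box t k) by rewrite /box; case: ifP.
transitivity (P ([set w | [set j] (J w)] `&`
    [set w | forall t k, box t k (X t k w)])).
  congr (P (_ `&` _)); apply/seteqP; split => w /=.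
    move=> Bw t k; rewrite /box; case: ifP => // /andP[/eqP -> kj].
    by apply: Bw; rewrite mem_enum.
  move=> Bw k; rewrite mem_enum inE => kj.
  by have := Bw tau k; rewrite /box eqxx kj.
rewrite indep//; congr (_ * _).
rewrite (bigD1 tau)//= [X in _ * X]big1 ?mule1; last first.
  move=> t /negbTE t_tau; apply: big1 => k _.
  by rewrite /box t_tau/= preimage_setT probability_setT.
rewrite (bigD1 j)//= /box !eqxx/= preimage_setT probability_setT mul1e.
by rewrite big_enum/=; apply: eq_bigr => k /= kj; rewrite kj PX.
Qed.

Hypotheses (n_gt1 : (1 < n)%N) (sigma_gt0 : (0 < sigma)%R).

Lemma unreplaced_sum_law (j : 'I_n) (C : set R) : measurable C ->
  P ([set w | C (\sum_(k <- enum (predC1 j)) X tau k w)%R] `&`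
     J @^-1` [set j]) =
  (n%:R^-1)%:E *
  normal_prob ((n%:R - 1) * mu)%R (sigma * Num.sqrt (n%:R - 1))%R C.
Proof.
move=> mC; have [mX mJ PJ _ _] := H0; set r := enum (predC1 j).
have natr_pred_n : n.-1%:R = (n%:R - 1)%R :> R by rewrite -subn1 natrB// ltnW.
have r_nil : r != [::].
  by rewrite -size_eq0 -cardE cardC1 card_ord -lt0n -ltnS prednK// ltnW.
have sigma_neq0 : sigma != 0%R by rewrite gt_eqF.
transitivity (mrestr P (mJ j) setT *
    normal_prob (\sum_(k <- r) mu)%R (Num.sqrt (\sum_(k <- r) sigma ^+ 2)) C).
  apply: (@measure_sum_normal _ _ _ _ (mrestr P (mJ j)) (X tau) (fun=> mu)
    (fun=> sigma) _ _ (mX tau)) => //; first exact: enum_uniq.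
  exact: unreplaced_row_independent.
congr (_ * normal_prob _ _ _); first by rewrite /mrestr setTI PJ.
  by rewrite big_enum/= sumr_const cardC1 card_ord -(mulr_natl mu) natr_pred_n.
rewrite big_enum/= sumr_const cardC1 card_ord -(mulr_natr (sigma ^+ 2)).
by rewrite natr_pred_n sqrtrM ?sqr_ge0// sqrtr_sqr gtr0_norm.
Qed.

Lemma beta_normal_prob (zs gamma : R) :
  beta P X J tau mu sigma zs gamma =
  normal_prob ((n%:R - 1) * mu)%R (sigma * Num.sqrt (n%:R - 1))%R
    (missed_sums n mu sigma zs gamma).
Proof.
have [mX mJ _ _ _] := H0; have mM := measurable_missed_sums n mu sigma zs gamma.
rewrite /beta; set miss := [set w | _].
have miss_fiber j : miss `&` J @^-1` [set j] =
    [set w | missed_sums n mu sigma zs gamma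
               (\sum_(k <- enum (predC1 j)) X tau k w)%R] `&` J @^-1` [set j].
  by apply/seteqP; split => w [+ Jw]; rewrite /miss/= rowmean_H1_data Jw.
rewrite (@measure_sum_fibers _ _ _ _ P J) => [|j]; last first.
  rewrite miss_fiber; apply: measurableI => //.
  rewrite -[X in measurable X]setTI.
  exact: (measurable_sum (enum (predC1 j)) (mX tau)).
rewrite (eq_bigr (fun=> (n%:R^-1)%:E * normal_prob ((n%:R - 1) * mu)%R
    (sigma * Num.sqrt (n%:R - 1))%R (missed_sums n mu sigma zs gamma)));
  last first.
  by move=> j _; rewrite miss_fiber; exact: unreplaced_sum_law.
rewrite -ge0_sume_distrl => [|j _]; last by rewrite lee_fin invr_ge0.
rewrite sumEFin sumr_const card_ord -(mulr_natl n%:R^-1) divff ?mul1e//.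
by rewrite pnatr_eq0 -lt0n ltnW.
Qed.

End type_II_error.

Theorem lemma3p6 (R : realType) (d : measure_display) (Omega : measurableType d)
    (P : probability Omega R) (T n : nat) (mu sigma zs : R) (tau : 'I_T)
    (X : 'I_T -> 'I_n -> Omega -> R) (J : Omega -> 'I_n) :
  (1 <= T)%N -> (2 <= n)%N -> 0 < sigma ->
  H0_with_index P X J mu sigma ->
  forall gamma : R, gamma <= gamma_max n mu sigma zs ->
  beta P X J tau mu sigma zs gamma =
  (Phi (acoef n mu sigma zs * Num.sqrt ((n%:R - 1) / n%:R)
        - bcoef n mu sigma zs gamma * Num.sqrt (n%:R / (n%:R - 1)))
   + Phi (- acoef n mu sigma zs * Num.sqrt ((n%:R - 1) / n%:R)
        - bcoef n mu sigma zs gamma * Num.sqrt (n%:R / (n%:R - 1))))%:E.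
Proof.
move=> _ n_gt1 sigma_gt0 H0 gamma gamma_le.
have sigma_neq0 : sigma != 0 by rewrite gt_eqF.
rewrite beta_normal_prob// normal_prob_missed_sums//.
by rewrite mulNr acoef_hit_center.
Qed.
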